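(* Let $N\ge 2$, $\alpha\in(0,1)$, and let $B_1$ be the open unit ball of $\mathbb{R}^N$ centered at the origin. Let $f:[0,\infty)\to\mathbb{R}$ be locally Lipschitz, and let $g:B_1\to\mathbb{R}$ be radially symmetric and decreasing in $|x|$. If $u$ is a positive classical solution of $$(-\Delta)^{\alpha}u=f(u)+g\ \text{ in } B_1,\qquad u=0\ \text{ in } B_1^c=\mathbb{R}^N\setminus B_1,$$ then $u$ is radially symmetric and strictly decreasing in $r=|x|$ for $r\in(0,1)$.
   Context: For $\alpha\in(0,1)$ the fractional Laplacian is $$(-\Delta)^\alpha u(x)=P.V.\int_{\mathbb{R}^N}\frac{u(x)-u(y)}{|x-y|^{N+2\alpha}}\,dy,$$ where $P.V.$ denotes the principal value at $y=x$. A classical solution is a continuous function $u:\mathbb{R}^N\to\mathbb{R}$ such that $(-\Delta)^\alpha u(x)$ is defined by this formula at every point $x\in B_1$ and such that the equation in $B_1$ and the condition in $B_1^c$ hold pointwise. Positive means $u>0$ in $B_1$. ''Decreasing'' without the word ''strictly'' is understood in the non-strict sense. *)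

(* Defs.v *)
From HB Require Import structures.
From mathcomp Require Import all_boot all_order all_algebra.
From mathcomp Require Import all_classical all_reals all_analysis.

Set Implicit Arguments.
Unset Strict Implicit.
Unset Printing Implicit Defensive.

Import Order.TTheory GRing.Theory Num.Theory.
Import numFieldNormedType.Exports.

Local Open Scope classical_set_scope.
Local Open Scope ring_scope.

(* R^n is ['rV[R]_n], with the library's topology on matrices (the one of the
   sup norm, hence the usual one).  The library has neither the Euclidean norm
   nor Lebesgue measure there. *)

Section borel_mx.
Context {R : realType} {m n : nat}.

Definition mx_measurable : set (set 'M[R]_(m, n)) :=
  <<s \bigcup_(ij in [set: 'I_m * 'I_n])
        preimage_set_system setT (fun A : 'M[R]_(m, n) => A ij.1 ij.2)
          (@measurable _ (measurableTypeR R)) >>.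

Let mx_measurable0 : mx_measurable set0.
Proof. exact: sigma_algebra0. Qed.

Let mx_measurableC A : mx_measurable A -> mx_measurable (~` A).
Proof. exact: sigma_algebraC. Qed.

Let mx_measurable_bigcup (F : (set 'M[R]_(m, n))^nat) :
  (forall i, mx_measurable (F i)) -> mx_measurable (\bigcup_i (F i)).
Proof. exact: sigma_algebra_bigcup. Qed.

HB.instance Definition _ := @isMeasurable.Build default_measure_display
  'M[R]_(m, n) mx_measurable mx_measurable0 mx_measurableC mx_measurable_bigcup.

Lemma measurable_coord (i : 'I_m) (j : 'I_n) :
  measurable_fun [set: 'M[R]_(m, n)]
    (fun A : 'M[R]_(m, n) => A i j : measurableTypeR R).
Proof.
move=> _ Y mY; rewrite setTI; apply: sub_sigma_algebra.
by exists (i, j) => //; exists Y => //; rewrite setTI.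
Qed.

Lemma measurable_fun_mx d (T : measurableType d) (f : T -> 'M[R]_(m, n)) :
  (forall i j, measurable_fun [set: T] (fun x => f x i j : measurableTypeR R)) ->
  measurable_fun [set: T] f.
Proof.
move=> mf _ Y mY; rewrite setTI.
suff : mx_measurable `<=` [set B | measurable (f @^-1` B)] by apply.
apply: smallest_sub.
  split => /=.
  - by rewrite preimage_set0.
  - by move=> A mA; rewrite setTD -preimage_setC; exact: measurableC.
  - by move=> F mF; rewrite preimage_bigcup; exact: bigcupT_measurable.
move=> B [[i j] _ [A mA <-]] /=; rewrite setTI.
by have := mf i j measurableT A mA; rewrite setTI.
Qed.

End borel_mx.

Section lebesgue_step.
Context {R : realType} (n : nat).
Variable mu : {sigma_finite_measure set 'rV[R]_n -> \bar R}.

Definition row_cons (p : measurableTypeR R * 'rV[R]_n) : 'rV[R]_n.+1 :=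
  \row_i (if unlift ord0 i is Some j then p.2 0 j else p.1).

Definition row_uncons (x : 'rV[R]_n.+1) : measurableTypeR R * 'rV[R]_n :=
  (x 0 ord0, \row_j x 0 (lift ord0 j)).

Lemma row_consK : cancel row_cons row_uncons.
Proof.
move=> [a x]; rewrite /row_uncons /row_cons mxE unlift_none; congr pair.
by apply/rowP => j; rewrite !mxE liftK.
Qed.

Lemma row_unconsK : cancel row_uncons row_cons.
Proof.
move=> x; apply/rowP => i; rewrite mxE.
by case: unliftP => [j|] ->; rewrite ?mxE.
Qed.

Lemma measurable_row_cons : measurable_fun [set: _] row_cons.
Proof.
apply: measurable_fun_mx => i k; rewrite [i]ord1 {i}.
under eq_fun do rewrite mxE.
case: unliftP => [j|] _; last exact: measurable_fst.
apply: (measurableT_comp (f := fun x : 'rV[R]_n => x 0 j : measurableTypeR R)).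
  exact: measurable_coord.
exact: measurable_snd.
Qed.

Lemma measurable_row_uncons : measurable_fun [set: _] row_uncons.
Proof.
apply/measurable_fun_pair; first exact: measurable_coord.
apply: measurable_fun_mx => i j.
under eq_fun do rewrite mxE.
exact: measurable_coord.
Qed.

Definition lebesgue_step : set 'rV[R]_n.+1 -> \bar R :=
  pushforward (@lebesgue_measure R \x mu)%E row_cons.

Let lebesgue_step0 : lebesgue_step set0 = 0%E.
Proof. by rewrite /lebesgue_step /pushforward preimage_set0 measure0. Qed.

Let lebesgue_step_ge0 A : (0 <= lebesgue_step A)%E.
Proof. by apply: integral_ge0 => x _; exact: measure_ge0. Qed.

Let lebesgue_step_sigma_additive : semi_sigma_additive lebesgue_step.
Proof.
pose m : {measure set _ -> \bar R} := (@lebesgue_measure R \x mu)%E.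
move=> F mF tF mUF; rewrite /lebesgue_step /pushforward preimage_bigcup.
apply: (@measure_semi_sigma_additive _ _ _ m).
- by move=> k; rewrite -[X in measurable X]setTI; exact: measurable_row_cons.
- apply/trivIsetP => i j _ _ ij; rewrite -preimage_setI.
  by move/trivIsetP : tF => /(_ _ _ _ _ ij) ->//; rewrite preimage_set0.
- rewrite -preimage_bigcup -[X in measurable X]setTI.
  exact: measurable_row_cons.
Qed.

HB.instance Definition _ := isMeasure.Build _ _ _ lebesgue_step
  lebesgue_step0 lebesgue_step_ge0 lebesgue_step_sigma_additive.

Let lebesgue_step_sigma_finite : sigma_finite setT lebesgue_step.
Proof.
have /sigma_finiteP[F [TF ndF Foo]] := sigma_finiteT (@lebesgue_measure R).
have /sigma_finiteP[G [TG ndG Goo]] := sigma_finiteT mu.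
exists (fun k => row_uncons @^-1` (F k `*` G k)).
  rewrite -preimage_bigcup (_ : \bigcup_k _ = setT) ?preimage_setT//.
  rewrite -subTset => -[a x] _.
  have [i _ Fia] : (\bigcup_k F k) a by rewrite -TF.
  have [j _ Gjx] : (\bigcup_k G k) x by rewrite -TG.
  exists (maxn i j) => //; split => /=.
  - by move: a Fia; exact/subsetPset/ndF/leq_maxl.
  - by move: x Gjx; exact/subsetPset/ndG/leq_maxr.
move=> k; have [mF Fk] := Foo k; have [mG Gk] := Goo k; split.
  rewrite -[X in measurable X]setTI; apply: measurable_row_uncons => //.
  exact: measurableX.
rewrite /lebesgue_step /pushforward -comp_preimage.
rewrite (_ : row_uncons \o row_cons = id) ?preimage_id//; last first.
  by apply/funext => p; exact: row_consK.
by rewrite product_measure1E// lte_mul_pinfty// ge0_fin_numE.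
Qed.

HB.instance Definition _ := Measure_isSigmaFinite.Build _ _ _ lebesgue_step
  lebesgue_step_sigma_finite.

End lebesgue_step.

Fixpoint lebesgue_rV (R : realType) (n : nat) :
    {sigma_finite_measure set 'rV[R]_n -> \bar R} :=
  match n with
  | 0 => dirac (0 : 'rV[R]_0)
  | n'.+1 => lebesgue_step (lebesgue_rV R n')
  end.
Arguments lebesgue_rV {R} n.

Lemma lebesgue_rV_box (R : realType) (n : nat) (A : 'I_n -> set R) :
  (forall i, measurable (A i)) ->
  lebesgue_rV n [set x : 'rV[R]_n | forall i, A i (x ord0 i)] =
    (\prod_(i < n) lebesgue_measure (A i))%E.
Proof.
elim: n A => [|n IH] A mA /=.
  rewrite big_ord0 /dirac indicE mem_set//=; by case.
rewrite /lebesgue_step /pushforward big_ord_recl.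
rewrite -(IH (fun i => A (lift ord0 i))) //.
rewrite -product_measure1E //; last first.
  rewrite (_ : mkset _ = \bigcap_(i in [set: 'I_n])
    [set x : 'rV[R]_n | A (lift ord0 i) (x ord0 i)]).
    apply: fin_bigcap_measurable => // i _.
    have := @measurable_coord R 1 n ord0 i measurableT _ (mA (lift ord0 i)).
    by rewrite setTI.
  by apply/seteqP; split => x /= h i; [move=> _|]; apply: h.
  exact: mA.
apply: (congr1 (fun B =>
  product_measure1 lebesgue_measure (lebesgue_rV n) B)).
apply/seteqP; split => -[a x] /= h.
  split; first by have := h ord0; rewrite /row_cons mxE unlift_none.
  by move=> i; have := h (lift ord0 i); rewrite /row_cons mxE liftK.
move=> i; rewrite /row_cons mxE; case: unliftP => [j|] -> /=; by case: h.
Qed.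

Section fractional_laplacian.
Context {R : realType} {N : nat}.
Implicit Types (u g : 'rV[R]_N -> R) (x y : 'rV[R]_N) (f : R -> R) (alpha : R).

Definition enorm x : R := Num.sqrt (\sum_i x 0 i ^+ 2).

Definition B1 : set 'rV[R]_N := [set x | enorm x < 1].

Definition frac_quotient alpha u x y : R :=
  (u x - u y) / enorm (x - y) `^ (N%:R + 2 * alpha).

Definition frac_truncated alpha u x (e : R) : R :=
  \int[lebesgue_rV N]_(y in [set y | e <= enorm (x - y)])
    frac_quotient alpha u x y.

(* [lim] and [\int] are total functions: this predicate says that the values
   they take in [frac_laplacian] are genuine, i.e. that the truncated integrals
   converge absolutely and that they have a finite limit as [e] tends to 0. *)
Definition frac_laplacian_defined alpha u x : Prop :=
  (forall e : R, 0 < e ->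
    (lebesgue_rV N).-integrable [set y | e <= enorm (x - y)]
      (fun y => (frac_quotient alpha u x y)%:E)) /\
  cvg (frac_truncated alpha u x e @[e --> 0^'+]).

Definition frac_laplacian alpha u x : R :=
  lim (frac_truncated alpha u x e @[e --> 0^'+]).

(* Only the values of [f] on [0, +oo[ and of [g] on the ball are used. *)
Definition classical_solution alpha f g u : Prop :=
  [/\ continuous u,
      forall x, B1 x -> frac_laplacian_defined alpha u x /\
                        frac_laplacian alpha u x = f (u x) + g x
    & forall x, ~ B1 x -> u x = 0].

Definition radially_symmetric_on (A : set 'rV[R]_N) u : Prop :=
  forall x y, A x -> A y -> enorm x = enorm y -> u x = u y.

Definition radially_decreasing_on (A : set 'rV[R]_N) u : Prop :=
  forall x y, A x -> A y -> enorm x <= enorm y -> u y <= u x.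

Definition radially_strictly_decreasing_on (A : set 'rV[R]_N) u : Prop :=
  forall x y, A x -> A y -> enorm x < enorm y -> u y < u x.

End fractional_laplacian.

(* Main.v *)
Require Import Defs.
From HB Require Import structures.
From mathcomp Require Import all_boot all_order all_algebra.
From mathcomp Require Import all_classical all_reals all_analysis.
From mathcomp Require Import measurable_realfun.
From mathcomp Require Import ring lra.
Set Implicit Arguments.
Unset Strict Implicit.
Unset Printing Implicit Defensive.
Import Order.TTheory GRing.Theory Num.Theory.
Import numFieldNormedType.Exports.
Local Open Scope classical_set_scope.
Local Open Scope ring_scope.

(** The proof is the method of moving planes, run on the pointwise values of the
   fractional Laplacian.  Fix a unit vector [e], and for [l > 0] let
   [refl e l] be the reflection across the hyperplane [dot y e = l] and
   [w y = u (refl e l y) - u y] the gap.  The aim is that [w > 0] at the points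
   of the closed unit ball beyond the hyperplane, for every [l > 0]: choosing
   the hyperplane that exchanges [x] and [y] then gives [u y < u x] whenever
   [enorm x < enorm y <= 1], and radial symmetry follows by continuity.

   The key estimate is [frac_laplacian_refl_le].  Suppose that [w] is minimal
   and nonpositive at [x], among the points beyond the hyperplane.  The
   truncated integrals at [x] and at its image are over regions exchanged by
   the reflection, so pairing each point with its image makes their difference
   an integral over the far half-space of
   [(w x - w y) K (|x - y|) + (w x + w y) K (|x - refl e l y|)].  As the image
   of [y] is farther from [x] than [y] is, this is at most
   [2 (w x) K (|x - refl e l y|)], which is nonpositive.  The continuity of [u]
   controls what happens close to [x] as the truncation goes to [0].

   Two consequences drive the moving plane.  At a negative minimum at distance
   [d] from the hyperplane, the difference is at most a positive constant times
   [(w x) d ^ (- 2 alpha)], while the equation bounds it below by [L (w x)],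
   because [f] is Lipschitz on the range of [u] and [g] increases under the
   reflection; so [d] is bounded below ([negative_minimum_far]).  If [w] is
   nonnegative beyond the hyperplane, it cannot vanish there at a point of the ball,
   since it is positive on the far part of the sphere ([gap_gt0]).  There is
   nothing to prove for [l >= 1]; if the admissible positions stopped at some
   [l0 > 0], then by compactness [w] would stay positive for slightly smaller
   [l] away from the hyperplane, and no negative minimum could exist close to
   it ([gap_ge0]).

   The change of variables rests on the invariance of the Lebesgue measure
   under [refl e l] ([preserves_refl]).  It is proved by Fubini for the
   directions [e] whose first coordinate does not vanish; these are enough,
   since two points of equal norm and equal first coordinate can be compared
   with a third one. *)

(** * Euclidean geometry of row vectors *)

Section euclidean.
Context {R : realType} {N : nat}.
Implicit Types (x y z e : 'rV[R]_N) (a l : R).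

Definition dot x y : R := \sum_i x 0 i * y 0 i.

Lemma dot0 x : dot x 0 = 0.
Proof. by apply: big1 => i _; rewrite mxE mulr0. Qed.

Lemma dotC x y : dot x y = dot y x.
Proof. by apply: eq_bigr => i _; rewrite mulrC. Qed.

Lemma dotDl x y z : dot (x + y) z = dot x z + dot y z.
Proof. by rewrite -big_split; apply: eq_bigr => i _; rewrite mxE mulrDl. Qed.

Lemma dotZl a x y : dot (a *: x) y = a * dot x y.
Proof. by rewrite mulr_sumr; apply: eq_bigr => i _; rewrite mxE mulrA. Qed.

Lemma dotNl x y : dot (- x) y = - dot x y.
Proof. by rewrite -scaleN1r dotZl mulN1r. Qed.

Lemma dotDr x y z : dot x (y + z) = dot x y + dot x z.
Proof. by rewrite dotC dotDl !(dotC _ x). Qed.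

Lemma dotZr a x y : dot x (a *: y) = a * dot x y.
Proof. by rewrite dotC dotZl dotC. Qed.

Lemma dotNr x y : dot x (- y) = - dot x y.
Proof. by rewrite dotC dotNl dotC. Qed.

Definition dotE := (dotDl, dotDr, dotNl, dotNr, dotZl, dotZr).

Lemma dot_ge0 x : 0 <= dot x x.
Proof. by apply: sumr_ge0 => i _; rewrite -expr2 sqr_ge0. Qed.

Lemma enormE x : enorm x = Num.sqrt (dot x x).
Proof. by []. Qed.

Lemma enorm_ge0 x : 0 <= enorm x.
Proof. exact: sqrtr_ge0. Qed.

Lemma sqr_enorm x : enorm x ^+ 2 = dot x x.
Proof. by rewrite sqr_sqrtr// dot_ge0. Qed.

Lemma enorm_lt x y : (enorm x < enorm y) = (dot x x < dot y y).
Proof. by rewrite -!sqr_enorm ltr_pXn2r// nnegrE enorm_ge0. Qed.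

Lemma enorm0 : enorm (0 : 'rV[R]_N) = 0.
Proof. by rewrite enormE dot0 sqrtr0. Qed.

Lemma dot_eq0 x : dot x x = 0 -> x = 0.
Proof.
move=> /eqP; rewrite psumr_eq0 => [/allP x0|i _]; last first.
  by rewrite -expr2 sqr_ge0.
apply/rowP => i; rewrite mxE.
by have := x0 i (mem_index_enum i); rewrite mulf_eq0 orbb => /eqP.
Qed.

Lemma enorm_gt0 x : x != 0 -> 0 < enorm x.
Proof.
apply: contraNT; rewrite -leNgt => x0; apply/eqP/dot_eq0.
by rewrite -sqr_enorm; apply/eqP; rewrite sqrf_eq0 eq_le x0 enorm_ge0.
Qed.

Lemma enorm_eq0 x : (enorm x == 0) = (x == 0).
Proof.
have [->|/enorm_gt0 x0] := eqVneq x 0; first by rewrite enorm0 eqxx.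
by rewrite gt_eqF.
Qed.

Lemma enormN x : enorm (- x) = enorm x.
Proof. by rewrite !enormE dotNl dotNr opprK. Qed.

Lemma enormC x y : enorm (x - y) = enorm (y - x).
Proof. by rewrite -enormN opprB. Qed.

Lemma enormZ a x : enorm (a *: x) = `|a| * enorm x.
Proof. by rewrite !enormE dotZl dotZr mulrA -expr2 sqrtrM ?sqr_ge0// sqrtr_sqr. Qed.

(** By expanding [0 <= |x - (x.e) e|^2]. *)
Lemma dot_unit_le x e : dot e e = 1 -> dot x e <= enorm x.
Proof.
move=> e1; have := dot_ge0 (x - dot x e *: e).
rewrite !dotE e1 (dotC e x) -sqr_enorm => h.
by have := enorm_ge0 x; nra.
Qed.

Lemma dot_le x y : dot x y <= enorm x * enorm y.
Proof.
have [->|y0] := eqVneq y 0.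
  by rewrite enorm0 mulr0 dot0.
have ny := enorm_gt0 y0; rewrite -ler_pdivrMr// mulrC -dotZr.
by apply: dot_unit_le; rewrite !dotE -sqr_enorm; field; rewrite gt_eqF.
Qed.

Lemma enormD x y : enorm (x + y) <= enorm x + enorm y.
Proof.
rewrite -(ler_pXn2r (_ : 0 < 2)%N)// ?nnegrE ?addr_ge0 ?enorm_ge0//.
rewrite sqr_enorm !dotE (dotC y x) -!sqr_enorm.
by have := dot_le x y; nra.
Qed.

Lemma coord_le_enorm x i : `|x 0 i| <= enorm x.
Proof.
rewrite -sqrtr_sqr enormE ler_sqrt ?dot_ge0// /dot (bigD1 i)//= -expr2.
by rewrite lerDl sumr_ge0// => j _; rewrite -expr2 sqr_ge0.
Qed.

(** The sharp constant is the square root of [N]; [N] is enough for comparing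
   cubes and balls up to constants. *)
Lemma enorm_le_coord x a : (forall i, `|x 0 i| <= a) -> enorm x <= N%:R * a.
Proof.
move=> xa.
suff [a0 h] : 0 <= N%:R * a /\ dot x x <= (N%:R * a) ^+ 2.
  by rewrite -(ler_pXn2r (_ : 0 < 2)%N)// ?nnegrE ?enorm_ge0// sqr_enorm.
have [N0|N0] := posnP N.
  rewrite N0 mul0r expr0n/= lexx /dot; split=> //.
  by rewrite big1// => -[i Hi]; exfalso; move: Hi; rewrite N0.
have a0 : 0 <= a by apply: le_trans (xa (Ordinal N0)).
split; first by rewrite mulr_ge0.
apply: (@le_trans _ _ (\sum_(i < N) a ^+ 2)).
  apply: ler_sum => i _; rewrite -expr2 -real_normK ?num_real//.
  by rewrite ler_pXn2r ?nnegrE.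
rewrite sumr_const card_ord -[leLHS]mulr_natl exprMn ler_wpM2r ?sqr_ge0//.
by rewrite -natrX ler_nat expnS expn1 leq_pmulr.
Qed.

End euclidean.

(** For a unit vector [e], the reflection across the hyperplane
   [{y | dot y e = l}].  It is locked because comparing [x - y] with
   [x - refl e l y] would otherwise unfold the matrix operations. *)
HB.lock Definition refl {R : realType} {N : nat} (e : 'rV[R]_N) (l : R)
  (x : 'rV[R]_N) : 'rV[R]_N := x - (2 * (dot x e - l)) *: e.

Section reflection.
Context {R : realType} {N : nat}.
Implicit Types x y : 'rV[R]_N.
Variables (e : 'rV[R]_N) (l : R).
Hypothesis e1 : dot e e = 1.

Let reflE x : refl e l x = x - (2 * (dot x e - l)) *: e.
Proof. by rewrite refl.unlock. Qed.

Lemma dot_refl x : dot (refl e l x) e = 2 * l - dot x e.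
Proof. by rewrite !reflE !dotE e1; ring. Qed.

Lemma reflK : involutive (refl e l).
Proof.
move=> x; rewrite reflE dot_refl (_ : 2 * l - _ - l = - (dot x e - l)).
  by rewrite mulrN scaleNr opprK reflE subrK.
by ring.
Qed.

Lemma dist_refl2 x y : enorm (refl e l x - refl e l y) = enorm (x - y).
Proof. by rewrite !enormE !reflE !dotE e1 !(dotC e); congr Num.sqrt; ring. Qed.

Lemma dist_refl x y : enorm (x - refl e l y) = enorm (refl e l x - y).
Proof. by rewrite -dist_refl2 reflK. Qed.

(** Behind every comparison of kernels: when [x] and [y] lie on the same side of
   the hyperplane, the image of [y] is farther from [x] than [y] is. *)
Lemma sqr_dist_refl x y :
  dot (x - refl e l y) (x - refl e l y) =
  dot (x - y) (x - y) + 4 * (dot x e - l) * (dot y e - l).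
Proof. by rewrite !reflE !dotE e1 !(dotC e) (dotC y x); ring. Qed.

Lemma sqr_enorm_refl x :
  dot (refl e l x) (refl e l x) = dot x x - 4 * l * (dot x e - l).
Proof. by rewrite !reflE !dotE e1 !(dotC e); ring. Qed.

(** A reflection across a hyperplane that does not contain the origin brings the
   points of the far side closer to the origin. *)
Lemma enorm_refl_lt x : 0 < l -> l < dot x e -> enorm (refl e l x) < enorm x.
Proof.
move=> l0 lx.
by rewrite enorm_lt sqr_enorm_refl gtrDl oppr_lt0 !mulr_gt0// subr_gt0.
Qed.

Lemma refl_fix x : dot x e = l -> refl e l x = x.
Proof. by rewrite reflE => ->; rewrite subrr mulr0 scale0r subr0. Qed.

End reflection.

(** * Continuity *)

Section continuity.
Context {R : realType} {N : nat}.
Implicit Types (e : 'rV[R]_N).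

Lemma cvg_dot T (F : set_system T) {FF : Filter F}
  (f g : T -> 'rV[R]_N) a b :
  f @ F --> a -> g @ F --> b -> (fun t => dot (f t) (g t)) @ F --> dot a b.
Proof.
move=> fa gb; rewrite /dot.
apply: cvg_big => [|i _]; first exact: add_continuous.
apply: cvgM.
  exact: (cvg_comp _ _ fa (@coord_continuous R 1 N 0 i a)).
exact: (cvg_comp _ _ gb (@coord_continuous R 1 N 0 i b)).
Qed.

Lemma cvg_enorm T (F : set_system T) {FF : Filter F}
  (f : T -> 'rV[R]_N) a :
  f @ F --> a -> (fun t => enorm (f t)) @ F --> enorm a.
Proof.
move=> fa.
apply: (@cvg_comp _ _ _ (fun t => dot (f t) (f t)) (@Num.sqrt R) F
  (nbhs (dot a a))).
  exact: cvg_dot.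
exact: sqrt_continuous.
Qed.

(** Joint in the position of the hyperplane and in the point, as moving the
   hyperplane requires. *)
Lemma cvg_reflection T (F : set_system T) {FF : Filter F} e
  (f : T -> R) (g : T -> 'rV[R]_N) a b : f @ F --> a -> g @ F --> b ->
  (fun t => refl e (f t) (g t)) @ F --> refl e a b.
Proof.
move=> fa gb; rewrite refl.unlock.
apply: cvgB => //; apply: cvgZr_tmp; apply: cvgM.
  exact: cvg_cst.
by apply: cvgB => //; apply: cvg_dot => //; exact: cvg_cst.
Qed.

Lemma continuous_enormB (x : 'rV[R]_N) :
  continuous (fun y : 'rV[R]_N => enorm (x - y)).
Proof.
move=> y; apply: (@cvg_enorm _ (nbhs y) _ (fun z : 'rV[R]_N => x - z) (x - y)).
by apply: cvgB; [exact: cvg_cst|exact: cvg_id].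
Qed.

Lemma continuous_refl e l : continuous (refl e l).
Proof.
move=> y; apply: (@cvg_reflection _ (nbhs y) _ e (fun=> l) id l y).
  exact: cvg_cst.
exact: cvg_id.
Qed.

(** The topology of row vectors is that of the sup norm, which is equivalent to
   the Euclidean norm. *)
Lemma near_enorm (x : 'rV[R]_N) (P : 'rV[R]_N -> Prop) :
  (\forall y \near x, P y) <->
  exists2 r, 0 < r & forall y, enorm (x - y) < r -> P y.
Proof.
split=> [/nbhs_ballP[r /= r0 rP]|[r r0 rP]].
  exists r => // y xy; apply: rP; split=> // i j /=; rewrite (ord1 i).
  apply: le_lt_trans xy; apply: le_trans (coord_le_enorm (x - y) j).
  by rewrite !mxE.
have h : (fun y : 'rV[R]_N => enorm (x - y)) @ x --> (0 : R).
  by have := @continuous_enormB x x; rewrite /continuous_at subrr enorm0.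
near=> y; apply: rP; near: y.
by move/cvgr_lt : h; apply.
Unshelve. all: by end_near. Qed.

End continuity.

(** * Invariance of the Lebesgue measure under reflections *)

Section preserves.
Local Open Scope ereal_scope.
Context {R : realType}.

Definition preserves d (T : measurableType d) (mu : set T -> \bar R)
    (s : T -> T) :=
  measurable_fun [set: T] s /\
  forall Y, measurable Y -> mu (s @^-1` Y) = mu Y.

Lemma preserves_comp d (T : measurableType d) (mu : set T -> \bar R)
    (s t : T -> T) :
  preserves mu s -> preserves mu t -> preserves mu (s \o t).
Proof.
move=> [ms s_mu] [mt t_mu]; split; first exact: measurableT_comp.
move=> Y mY; rewrite comp_preimage t_mu ?s_mu//.
by rewrite -[X in measurable X]setTI; exact: ms.
Qed.

Section product.
Context d1 d2 (T1 : measurableType d1) (T2 : measurableType d2).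
Variables (m1 : {sigma_finite_measure set T1 -> \bar R}).
Variables (m2 : {sigma_finite_measure set T2 -> \bar R}).

(** By Fubini: the measure of a set is the integral of the measures of its
   sections, and the section at [a] is moved by [h a]. *)
Lemma preserves_snd (h : T1 -> T2 -> T2) :
  measurable_fun [set: T1 * T2] (fun p => h p.1 p.2) ->
  (forall a, preserves m2 (h a)) ->
  preserves (m1 \x m2) (fun p => (p.1, h p.1 p.2)).
Proof.
move=> mh hm; split.
  by apply/measurable_fun_pair => //; exact: measurable_fst.
move=> Y mY; apply: eq_integral => a _ /=.
have [_ /(_ (xsection Y a)) <-] := hm a; last exact: measurable_xsection.
by congr (m2 _); apply/seteqP; split => x; rewrite /xsection /= !inE.
Qed.

(** The sections are now taken in the other direction, which is allowed because
   the two iterated integrals agree for sigma-finite measures. *)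
Lemma preserves_fst (h : T1 -> T2 -> T1) :
  measurable_fun [set: T1 * T2] (fun p => h p.1 p.2) ->
  (forall b, preserves m1 (h^~ b)) ->
  preserves (m1 \x m2) (fun p => (h p.1 p.2, p.2)).
Proof.
move=> mh hm; set s := (fun p => _).
have ms : measurable_fun [set: T1 * T2] s.
  by apply/measurable_fun_pair => //; exact: measurable_snd.
split=> // Y mY.
have msY : measurable (s @^-1` Y).
  by rewrite -[X in measurable X]setTI; exact: ms.
have E X : measurable X -> (m1 \x m2) X = (m1 \x^ m2) X.
  by apply: product_measure_unique => A B mA mB; exact: product_measure2E.
rewrite !E//; apply: eq_integral => b _ /=.
have [_ /(_ (ysection Y b)) <-] := hm b; last exact: measurable_ysection.
by congr (m1 _); apply/seteqP; split => x; rewrite /ysection /= !inE.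
Qed.

End product.

Lemma preserves_shift (c : R) :
  preserves (@lebesgue_measure R) (fun a : measurableTypeR R => (a + c)%R).
Proof.
have ms : measurable_fun [set: measurableTypeR R]
    (fun a : measurableTypeR R => (a + c)%R : measurableTypeR R).
  exact: measurable_funD.
split=> // Y mY.
rewrite -[LHS]/(pushforward (@lebesgue_measure R) (_ : _ -> measurableTypeR R) Y).
apply/esym/lebesgue_measure_unique => //= _ [[a b]] _ <-.
rewrite /pushforward (_ : _ @^-1` _ = `](a - c)%R, (b - c)%R]%classic).
  rewrite !lebesgue_measure_itv/= !lte_fin ltrD2r.
  by case: ifP => // _; rewrite -!EFinB; congr EFin; ring.
by apply/seteqP; split => x /=; rewrite !in_itv/= ltrBlDr lerBrDr.
Qed.

Lemma preserves_flip (c : R) :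
  preserves (@lebesgue_measure R) (fun a : measurableTypeR R => (c - a)%R).
Proof.
have mN : measurable_fun [set: measurableTypeR R]
    (fun a : measurableTypeR R => (- a)%R : measurableTypeR R).
  exact: measurable_funN.
rewrite (_ : (fun a => _) =
  (fun a : measurableTypeR R => (a + c)%R : measurableTypeR R) \o
  (fun a : measurableTypeR R => (- a)%R : measurableTypeR R)); last first.
  by apply/funext => a /=; rewrite addrC.
apply: preserves_comp; first exact: preserves_shift.
by split=> // Y mY; exact: lebesgue_measureN.
Qed.

Lemma preserves_row_cons n (s : measurableTypeR R * 'rV[R]_n -> _) :
  preserves (@lebesgue_measure R \x lebesgue_rV n) s ->
  preserves (lebesgue_rV n.+1) (@row_cons R n \o s \o @row_uncons R n).
Proof.
move=> [ms s_mu]; split.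
  apply: measurableT_comp; last exact: measurable_row_uncons.
  by apply: measurableT_comp => //; exact: measurable_row_cons.
move=> Y mY; have mY' : measurable (@row_cons R n @^-1` Y).
  by rewrite -[X in measurable X]setTI; exact: measurable_row_cons.
rewrite /= /lebesgue_step /pushforward -(s_mu _ mY').
congr ((_ \x _) _); apply/seteqP; split => p /=; by rewrite row_consK.
Qed.

Lemma preserves_translation n (v : 'rV[R]_n) :
  preserves (lebesgue_rV n) (fun x => (x + v)%R).
Proof.
elim: n v => [|n IH] v.
  rewrite (_ : (fun x => _) = id) //.
  by apply/funext => x; apply/rowP => -[].
pose b := v ord0 ord0; pose w := (row_uncons v).2.
pose s1 (p : measurableTypeR R * 'rV[R]_n) : measurableTypeR R * 'rV[R]_n :=
  (p.1, (p.2 + w)%R).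
pose s2 (p : measurableTypeR R * 'rV[R]_n) : measurableTypeR R * 'rV[R]_n :=
  ((p.1 + b)%R, p.2).
have s1_mu : preserves (@lebesgue_measure R \x lebesgue_rV n) s1.
  apply: (preserves_snd (@lebesgue_measure R) (m2 := lebesgue_rV n)
    (h := fun _ x => (x + w)%R)) => //.
  apply: (measurableT_comp (f := fun x : 'rV[R]_n => (x + w)%R)) => //.
  by case: (IH w).
have s2_mu : preserves (@lebesgue_measure R \x lebesgue_rV n) s2.
  apply: (preserves_fst (m1 := @lebesgue_measure R) (lebesgue_rV n)
    (h := fun a _ => (a + b)%R)) => //.
    exact: measurable_funD.
  by move=> _; exact: preserves_shift.
rewrite (_ : (fun x => _) = @row_cons R n \o (s1 \o s2) \o @row_uncons R n).
  exact: preserves_row_cons (preserves_comp s1_mu s2_mu).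
apply/funext => x; apply/rowP => i.
rewrite /s1 /s2 /row_cons /row_uncons !mxE /=.
by case: unliftP => [j|] -> /=; rewrite ?mxE.
Qed.

(** Write [e = b (1, v)], where [b] is the first coordinate of [e].  The shear
   [(a, w) -> (a, w + a *: v)] maps the first axis to the line of [e], hence
   conjugates the reflection to a map that fixes [w] and flips [a] around a
   centre depending on [w].  Both maps preserve the measure by Fubini. *)
Lemma preserves_refl n (e : 'rV[R]_n.+1) (l : R) : dot e e = 1%R ->
  e ord0 ord0 != 0%R -> preserves (lebesgue_rV n.+1) (refl e l).
Proof.
move=> e1 e0; pose b := e ord0 ord0; pose e' := (row_uncons e).2.
pose v := (b^-1 *: e')%R.
pose sh (c : R) (p : measurableTypeR R * 'rV[R]_n) :
    measurableTypeR R * 'rV[R]_n :=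
  (p.1, (p.2 + (c * p.1) *: v)%R).
pose fl (p : measurableTypeR R * 'rV[R]_n) : measurableTypeR R * 'rV[R]_n :=
  ((2 * l * b - 2 * b * dot p.2 e' - p.1)%R, p.2).
have sh_mu c : preserves (@lebesgue_measure R \x lebesgue_rV n) (sh c).
  apply: (preserves_snd (@lebesgue_measure R) (m2 := lebesgue_rV n)
    (h := fun a x => (x + (c * a) *: v)%R)) => //.
    apply: measurable_fun_mx => i j.
    under eq_fun do rewrite !mxE.
    apply: measurable_funD.
      apply: (measurableT_comp (f := fun x : 'rV[R]_n => x i j : measurableTypeR R)).
        exact: measurable_coord.
      exact: measurable_snd.
    apply: measurable_funM => //; apply: measurable_funM => //.
  move=> a; exact: preserves_translation.
have fl_mu : preserves (@lebesgue_measure R \x lebesgue_rV n) fl.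
  apply: (preserves_fst (m1 := @lebesgue_measure R) (lebesgue_rV n)
    (h := fun a w => (2 * l * b - 2 * b * dot w e' - a)%R)) => //.
    apply: measurable_funB => //; apply: measurable_funB => //.
    apply: measurable_funM => //; apply: measurable_sum => i.
    apply: measurable_funM => //.
    apply: (measurableT_comp (f := fun x : 'rV[R]_n => x 0%R i : measurableTypeR R)).
      exact: measurable_coord.
    exact: measurable_snd.
  move=> w; exact: preserves_flip.
rewrite (_ : refl e l =
  @row_cons R n \o (sh 1%R \o (fl \o sh (- 1)%R)) \o @row_uncons R n).
  exact: preserves_row_cons (preserves_comp _ (preserves_comp _ _)).
have dotE0 x : dot x e = (x ord0 ord0 * b + dot (row_uncons x).2 e')%R.
  rewrite /dot big_ord_recl; congr (_ + _)%R.
  by apply: eq_bigr => i _; rewrite !mxE.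
have bb : (b ^+ 2 + dot e' e' = 1)%R by rewrite -e1 dotE0 expr2.
have b0 : b != 0%R by [].
apply/funext => x; apply/rowP => i.
rewrite refl.unlock dotE0 /sh /fl /row_cons !mxE /=.
set y := (row_uncons x).2; set a := x ord0 ord0.
have -> : dot (y + (-1 * a) *: v)%R e' = (dot y e' - a / b * dot e' e')%R.
  by rewrite /v !dotE mulN1r mulNr mulrA.
have {}bb : dot e' e' = (1 - b ^+ 2)%R by apply/eqP; rewrite eq_sym subr_eq addrC bb.
rewrite bb.
case: unliftP => [j|] -> /=; rewrite ?mxE -/b -/a; last by field.
rewrite -!/(e _ _); set ej := e _ _; set xj := x _ _.
by field.
Qed.

End preserves.

(** * Integrals and measure preserving maps *)

Section change_of_variable.
Context {R : realType} d (T : measurableType d).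
Variable mu : {measure set T -> \bar R}.

Lemma integrable_Rintegral_indic (A : set T) : measurable A ->
  (mu A < +oo)%E ->
  mu.-integrable [set: T] (EFin \o \1_A) /\
  \int[mu]_x \1_A x = fine (mu A).
Proof.
move=> mA Aoo; split; last by rewrite /Rintegral integral_indic// setIT.
apply/integrableP; split; first exact/measurable_EFinP.
under eq_integral do rewrite /= ger0_norm//.
by rewrite integral_indic// setIT.
Qed.

Lemma integrable_EFinD (p q : T -> R) :
  mu.-integrable [set: T] (EFin \o p) -> mu.-integrable [set: T] (EFin \o q) ->
  mu.-integrable [set: T] (EFin \o (fun y => p y + q y)).
Proof. by move=> ip iq; exact: (integrableD measurableT ip iq). Qed.

Lemma integrable_EFinB (p q : T -> R) :
  mu.-integrable [set: T] (EFin \o p) -> mu.-integrable [set: T] (EFin \o q) ->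
  mu.-integrable [set: T] (EFin \o (fun y => p y - q y)).
Proof. by move=> ip iq; exact: (integrableB measurableT ip iq). Qed.

Lemma integrable_EFinZ (a : R) (p : T -> R) :
  mu.-integrable [set: T] (EFin \o p) ->
  mu.-integrable [set: T] (EFin \o (fun y => a * p y)).
Proof. by move=> ip; exact: (integrableZl measurableT a ip). Qed.

Lemma preserves_Rintegral (s : T -> T) (f : T -> R) : preserves mu s ->
  mu.-integrable [set: T] (EFin \o f) ->
  mu.-integrable [set: T] (EFin \o (f \o s)) /\
  \int[mu]_x f (s x) = \int[mu]_x f x.
Proof.
move=> [ms s_mu] intf; have /integrableP[mf foo] := intf.
have s_mu' A : measurable A -> A `<=` setT -> mu A = pushforward mu s A.
  by move=> mA _; rewrite -s_mu.
have intfs : mu.-integrable [set: T] (EFin \o (f \o s)).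
  apply/integrableP; split; first exact: measurableT_comp mf ms.
  apply: le_lt_trans foo.
  rewrite [leRHS](eq_measure_integral _ s_mu') [leRHS]ge0_integral_pushforward//.
  exact: measurableT_comp.
split=> //; congr fine.
rewrite [RHS](eq_measure_integral _ s_mu').
by rewrite [RHS](integral_pushforward ms mf intfs measurableT).
Qed.

Lemma integrable_patch (D : set T) (p : T -> R) : measurable D ->
  mu.-integrable D (EFin \o p) ->
  mu.-integrable [set: T] (EFin \o (p \_ D)).
Proof. by move=> mD ip; rewrite -restrict_EFin; apply/(integrable_mkcond _ mD).1. Qed.

(** Averaging [f - g] with its image under [s] does not change its integral, so
   that only the average has to be bounded. *)
Lemma preserves_Rintegral_le (s : T -> T) (f g : T -> R) (C Q : set T)
    (h c : R) : preserves mu s ->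
  mu.-integrable [set: T] (EFin \o f) -> mu.-integrable [set: T] (EFin \o g) ->
  measurable C -> (mu C < +oo)%E -> measurable Q -> (mu Q < +oo)%E ->
  (forall y, (f y - g y) + (f (s y) - g (s y)) <=
             h * \1_C y + h * \1_C (s y) - c * \1_Q y) ->
  \int[mu]_y f y - \int[mu]_y g y <= h * fine (mu C) - c * fine (mu Q) / 2.
Proof.
move=> s_mu intf intg mC Coo mQ Qoo H.
have [intfs fs] := preserves_Rintegral s_mu intf.
have [intgs gs] := preserves_Rintegral s_mu intg.
have [intC CE] := integrable_Rintegral_indic mC Coo.
have [intQ QE] := integrable_Rintegral_indic mQ Qoo.
have [intCs CsE] := preserves_Rintegral s_mu intC.
have iC := integrable_EFinZ h intC.
have iCs := integrable_EFinZ h intCs.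
have iQ := integrable_EFinZ c intQ.
have iG := integrable_EFinB intf intg.
have iGs := integrable_EFinB intfs intgs.
suff : \int[mu]_y ((f y - g y) + (f (s y) - g (s y))) <=
       \int[mu]_y (h * \1_C y + h * \1_C (s y) - c * \1_Q y).
  rewrite (RintegralD measurableT iG iGs).
  rewrite (RintegralB measurableT intf intg) (RintegralB measurableT intfs intgs).
  rewrite (RintegralB measurableT (integrable_EFinD iC iCs) iQ).
  rewrite (RintegralD measurableT iC iCs) !RintegralZl//.
  rewrite fs gs CsE CE QE => le.
  by rewrite -(ler_pM2l (_ : 0 < 2))//; lra.
apply: le_Rintegral => //.
- by apply: integrable_EFinD; exact: integrable_EFinB.
- by apply: integrable_EFinB iQ; exact: integrable_EFinD iC iCs.
Qed.

End change_of_variable.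

Section cube.
Context {R : realType} {n : nat}.
Implicit Types x : 'rV[R]_n.

Definition cube x (r : R) : set 'rV[R]_n :=
  [set y | forall i, `[x 0 i - r, x 0 i + r]%classic (y ord0 i)].

Lemma cubeP x r y : cube x r y <-> forall i, `|(x - y) 0 i| <= r.
Proof.
by split=> h i; have := h i; rewrite /= in_itv/= !mxE distrC ler_distl.
Qed.

Lemma measurable_cube x r : measurable (cube x r).
Proof.
rewrite (_ : cube x r = \bigcap_(i in [set: 'I_n])
    [set y : 'rV[R]_n | `[x 0 i - r, x 0 i + r]%classic (y ord0 i)]).
  apply: fin_bigcap_measurable => // i _.
  have mI : measurable (`[x 0 i - r, x 0 i + r]%classic : set (measurableTypeR R)).
    exact: measurable_itv.
  by have := @measurable_coord R 1 n ord0 i measurableT _ mI; rewrite setTI.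
by apply/seteqP; split => y h i; [move=> _|]; apply: h.
Qed.

Lemma lebesgue_cube x r : 0 < r -> lebesgue_rV n (cube x r) = ((2 * r) ^+ n)%:E.
Proof.
move=> r0; rewrite (@lebesgue_rV_box R n (fun i => `[x 0 i - r, x 0 i + r]%classic)).
  2: by move=> i; exact: measurable_itv.
rewrite (eq_bigr (fun=> (2 * r)%:E)) => [|i _].
  by rewrite prodEFin prodr_const card_ord.
rewrite lebesgue_measure_itv/= lte_fin ifT; last by lra.
by rewrite -EFinB; congr EFin; ring.
Qed.

End cube.

(** * The fractional Laplacian at two symmetric points *)

Section kernel_comparison.
Context {R : realType} {n : nat}.
Variables (alpha : R) (u : 'rV[R]_n.+1 -> R) (e : 'rV[R]_n.+1) (l : R).
Hypotheses (alpha0 : 0 < alpha) (e1 : dot e e = 1) (e0 : e ord0 ord0 != 0).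
Let N := n.+1.
Let mu := @lebesgue_rV R N.
Local Notation s := (refl e l).
Implicit Types (x y z : 'rV[R]_n.+1).

Definition frac_kernel (r : R) : R := (r `^ (N%:R + 2 * alpha))^-1.

Local Notation K := frac_kernel.

Definition refl_gap y : R := u (refl e l y) - u y.

Local Notation w := refl_gap.

Lemma continuous_refl_gap : continuous u -> continuous w.
Proof.
move=> cu y; have cus : u (s z) @[z --> y] --> u (s y).
  by apply: continuous_comp; [exact: continuous_refl|exact: cu].
exact: cvgB cus (cu y).
Qed.

Let exponent_gt0 : 0 < N%:R + 2 * alpha :> R.
Proof. by rewrite addr_gt0 ?mulr_gt0// ltr0n. Qed.

Lemma frac_kernel_gt0 r : 0 < r -> 0 < K r.
Proof. by move=> r0; rewrite invr_gt0 powR_gt0. Qed.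

Lemma frac_kernel_ge0 r : 0 <= K r.
Proof. by rewrite invr_ge0 powR_ge0. Qed.

Lemma frac_kernel_le r r' : 0 < r -> r <= r' -> K r' <= K r.
Proof.
move=> r0 rr'; have r'0 := lt_le_trans r0 rr'.
rewrite lef_pV2 ?posrE ?powR_gt0//.
by apply: ge0_ler_powR; [exact: ltW exponent_gt0|..|exact: rr'];
  rewrite nnegrE ltW.
Qed.

Lemma frac_kernel_lt r r' : 0 < r -> r < r' -> K r' < K r.
Proof.
move=> r0 rr'; have r'0 := lt_trans r0 rr'.
rewrite ltf_pV2 ?posrE ?powR_gt0//.
by apply: gt0_ltr_powR; [exact: exponent_gt0|..|exact: rr'];
  rewrite nnegrE ltW.
Qed.

Lemma measurable_enorm_ge x (c : R) : 0 < c ->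
  measurable [set y : 'rV[R]_n.+1 | c <= enorm (x - y)].
Proof.
move=> c0; have -> : [set y : 'rV[R]_n.+1 | c <= enorm (x - y)] =
    (fun y : 'rV[R]_n.+1 => dot (x - y) (x - y)) @^-1` `[c ^+ 2, +oo[%classic.
  apply/seteqP; split => y /=; rewrite in_itv/= andbT -sqr_enorm.
    by rewrite ler_pXn2r ?nnegrE ?enorm_ge0 ?(ltW c0).
  by rewrite ler_pXn2r ?nnegrE ?enorm_ge0 ?(ltW c0).
rewrite -[X in measurable X]setTI.
suff h : measurable_fun [set: 'rV[R]_n.+1]
    (fun y : 'rV[R]_n.+1 => dot (x - y) (x - y)).
  by apply: h => //; exact: measurable_itv.
apply: measurable_sum => i.
have h : measurable_fun [set: 'rV[R]_n.+1] (fun y : 'rV[R]_n.+1 => (x - y) 0 i).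
  under eq_fun do rewrite !mxE.
  by apply: measurable_funB => //; exact: measurable_coord.
exact: measurable_funM.
Qed.

Let quotient_pair (b1 b2 : bool) (k1 k2 ux usx uy usy : R) :
  (if b2 then (usx - uy) * k2 else 0) - (if b1 then (ux - uy) * k1 else 0) +
  ((if b1 then (usx - usy) * k1 else 0) - (if b2 then (ux - usy) * k2 else 0)) =
  (if b1 then (usx - ux - (usy - uy)) * k1 else 0) +
  (if b2 then (usx - ux + (usy - uy)) * k2 else 0).
Proof. by case: b1; case: b2; ring. Qed.

Lemma symmetrized_quotientE x y (eps : R) :
  let f := (frac_quotient alpha u (s x) \_ [set y | eps <= enorm (s x - y)]) in
  let g := (frac_quotient alpha u x \_ [set y | eps <= enorm (x - y)]) in
  (f y - g y) + (f (s y) - g (s y)) =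
  (if eps <= enorm (x - y) then (w x - w y) * K (enorm (x - y)) else 0) +
  (if eps <= enorm (x - s y) then (w x + w y) * K (enorm (x - s y)) else 0).
Proof.
have patch0 x' z :
    (frac_quotient alpha u x' \_ [set y | eps <= enorm (x' - y)]) z =
    if eps <= enorm (x' - z) then frac_quotient alpha u x' z else 0.
  by rewrite patchE; congr (if _ then _ else _); apply/idP/idP; rewrite inE.
have qE x' z : frac_quotient alpha u x' z = (u x' - u z) * K (enorm (x' - z)).
  by [].
rewrite /= (patch0 (s x) y) (patch0 x y) (patch0 (s x) (s y)) (patch0 x (s y)).
rewrite (qE x y) (qE x (s y)) (qE (s x) y) (qE (s x) (s y)).
by rewrite -(dist_refl _ e1) (dist_refl2 _ e1) quotient_pair.
Qed.

(** The two truncated integrals are over regions exchanged by the reflection.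
   Averaging the difference of the integrands with its image under the
   reflection leaves only values of the gap, which a combination of indicators
   is enough to bound. *)
Lemma truncated_gap_le x (eps : R) (C Q : set 'rV[R]_n.+1) (h c : R) :
  0 < eps ->
  mu.-integrable [set y | eps <= enorm (x - y)]
    (EFin \o (frac_quotient alpha u x)) ->
  mu.-integrable [set y | eps <= enorm (s x - y)]
    (EFin \o (frac_quotient alpha u (s x))) ->
  measurable C -> (mu C < +oo)%E -> measurable Q -> (mu Q < +oo)%E ->
  (forall y,
    (if eps <= enorm (x - y) then (w x - w y) * K (enorm (x - y)) else 0) +
    (if eps <= enorm (x - s y) then (w x + w y) * K (enorm (x - s y)) else 0)
    <= h * \1_C y + h * \1_C (s y) - c * \1_Q y) ->
  frac_truncated alpha u (s x) eps - frac_truncated alpha u x eps <=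
    h * fine (mu C) - c * fine (mu Q) / 2.
Proof.
move=> eps0 int_x int_sx mC Coo mQ Qoo H.
have s_mu : preserves mu s by exact: preserves_refl.
rewrite /frac_truncated (Rintegral_mkcond _ [set y | eps <= enorm (s x - y)]).
rewrite (Rintegral_mkcond _ [set y | eps <= enorm (x - y)]).
apply: (preserves_Rintegral_le s_mu) => //.
- by apply: integrable_patch int_sx; exact: measurable_enorm_ge.
- by apply: integrable_patch int_x; exact: measurable_enorm_ge.
by move=> y; rewrite symmetrized_quotientE; exact: H.
Qed.

(** The contribution of the pair [y, s y] to the difference between the
   fractional Laplacians of [u] at [s x] and at [x]. *)
Definition pair_gap x y : R :=
  (w x - w y) * K (enorm (x - y)) + (w x + w y) * K (enorm (x - s y)).

Lemma refl_gap_refl y : w (s y) = - w y.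
Proof. by rewrite /refl_gap (reflK l e1) opprB. Qed.

Lemma enorm_lt_dist_refl x y : l < dot x e -> l < dot y e ->
  enorm (x - y) < enorm (x - s y).
Proof.
move=> lx ly; rewrite enorm_lt sqr_dist_refl// ltrDl.
by rewrite !mulr_gt0 ?subr_gt0.
Qed.

Lemma dist_refl_ge x y : l < dot y e -> dot x e - l <= enorm (x - s y).
Proof.
move=> ly; apply: le_trans (dot_unit_le _ e1).
by rewrite dotDl dotNl dot_refl//; lra.
Qed.

(** The image of [y] is farther from [x] than [y] is, so that replacing the
   larger kernel by the smaller one in front of the nonpositive [w x - w y] can
   only increase the sum, in which [w y] then cancels. *)
Lemma pair_gap_le x y : l < dot x e -> l < dot y e -> x != y -> w x <= w y ->
  pair_gap x y <= 2 * w x * K (enorm (x - s y)).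
Proof.
move=> lx ly xy wxy; have Kxy : K (enorm (x - s y)) <= K (enorm (x - y)).
  apply: frac_kernel_le; last exact/ltW/enorm_lt_dist_refl.
  by rewrite enorm_gt0// subr_eq0.
rewrite /pair_gap; move: Kxy wxy; move: (w x) (w y) => a b.
by move: (K (enorm (x - y))) (K _) => k1 k2; nra.
Qed.

(** The heart of the argument.  At a point [x] of the half-space where the gap
   is nonpositive and minimal, the fractional Laplacian of [u] at the image of
   [x] is at most that at [x], and smaller by a definite amount if the integrand
   is controlled on a set [Q] away from [x].  Near [x], where the truncation
   kills only one of the two terms, the continuity of [u] is enough because the
   other term carries no singularity. *)
Lemma frac_laplacian_refl_le x (Q : set 'rV[R]_n.+1) (rho c : R) :
  continuous u ->
  frac_laplacian_defined alpha u x -> frac_laplacian_defined alpha u (s x) ->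
  l < dot x e -> w x <= 0 -> (forall y, l < dot y e -> w x <= w y) ->
  measurable Q -> (mu Q < +oo)%E -> 0 <= c -> 0 < rho ->
  (forall y, Q y ->
    [/\ l < dot y e, rho <= enorm (x - y) & pair_gap x y <= - c]) ->
  frac_laplacian alpha u (s x) - frac_laplacian alpha u x <=
    - (c * fine (mu Q) / 2).
Proof.
move=> cu [int_x cvg_x] [int_sx cvg_sx] lx wx0 wmin mQ Qoo c0 rho0 HQ.
pose d := dot x e - l; have d0 : 0 < d by rewrite subr_gt0.
have Kd0 := frac_kernel_gt0 d0.
have C0 : (0 : R) <= fine (mu (cube x 1)) by rewrite fine_ge0.
apply/ler_addgt0Pr => eta eta0.
(* [h] is the oscillation of the gap allowed near [x]: with the kernel at most
   [K d] there, a cube of side 2 contributes at most [eta]. *)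
pose h := eta / (K d * (fine (mu (cube x 1)) + 1)).
have h0 : 0 < h by rewrite divr_gt0// mulr_gt0// ltr_wpDl.
have h_eta : h * K d * fine (mu (cube x 1)) <= eta.
  rewrite /h; move: C0 (K d) Kd0; move: (fine _) => A A0 k k0.
  rewrite (_ : _ * A = eta * (A / (A + 1))); last first.
    by field; rewrite !gt_eqF// ltr_wpDl.
  by rewrite ler_piMr ?(ltW eta0)// ler_pdivrMr ?ltr_wpDl// mul1r lerDl.
have cw := continuous_refl_gap cu.
have /near_enorm[r r0 wr] : \forall y \near x, w y <= w x + h.
  by apply: (cvgr_le _ (cw x)); rewrite ltrDl.
suff H : \forall eps \near (0 : R)^'+,
    frac_truncated alpha u (s x) eps - frac_truncated alpha u x eps <=
    - (c * fine (mu Q) / 2) + eta.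
  have := limr_le (is_cvgB cvg_sx cvg_x) H; rewrite (limB cvg_sx cvg_x); apply.
near=> eps.
have eps0 : 0 < eps by near: eps; exact: nbhs_right_gt.
have eps_r : eps < r by near: eps; exact: nbhs_right_lt.
have eps_d : eps < d by near: eps; exact: nbhs_right_lt.
have eps_rho : eps < rho by near: eps; exact: nbhs_right_lt.
have eps_1 : eps < 1 by near: eps; exact: nbhs_right_lt.
apply: (@le_trans _ _ (h * K d * fine (mu (cube x 1)) - c * fine (mu Q) / 2)).
  2: by rewrite addrC lerD2l.
apply: truncated_gap_le => //; [exact: int_x|exact: int_sx| | |].
- exact: measurable_cube.
- by rewrite /mu lebesgue_cube// ltry.
have hC y : 0 <= h * K d * \1_(cube x 1) y.
  by rewrite mulr_ge0// mulr_ge0 ?ltW.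
have main y : l < dot y e ->
    (if eps <= enorm (x - y) then (w x - w y) * K (enorm (x - y)) else 0) +
    (if eps <= enorm (x - s y) then (w x + w y) * K (enorm (x - s y)) else 0)
    <= h * K d * \1_(cube x 1) y + h * K d * \1_(cube x 1) (s y) - c * \1_Q y.
  move=> ly; have xsy := dist_refl_ge x ly.
  have -> : eps <= enorm (x - s y) by apply: le_trans xsy; exact: ltW.
  have [far|close] := leP eps (enorm (x - y)).
    rewrite -/(pair_gap x y).
    have [Qy|nQy] := pselect (Q y).
      have [_ _ le_c] := HQ _ Qy.
      rewrite [\1_Q y]indicE mem_set// mulr1; apply: le_trans le_c _.
      by rewrite lerDr addr_ge0.
    rewrite [\1_Q y]indicE memNset// mulr0 subr0.
    apply: (@le_trans _ _ 0); last by rewrite addr_ge0.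
    apply: le_trans (pair_gap_le lx ly _ (wmin _ ly)) _.
      apply: contraTneq far => ->; rewrite subrr enorm0 -ltNge.
      exact: eps0.
    by rewrite mulr_le0_ge0 ?frac_kernel_ge0// pmulr_rle0.
  have nQy : ~ Q y.
    by move=> /HQ[_ + _]; apply/negP; rewrite -ltNge (lt_trans close).
  have Cy : cube x 1 y.
    apply/cubeP => i; apply: le_trans (coord_le_enorm _ _) _.
    by rewrite ltW// (lt_trans close).
  rewrite [\1_Q y]indicE memNset// mulr0 subr0 add0r.
  rewrite [\1_(cube x 1) y]indicE mem_set// mulr1.
  apply: (@le_trans _ _ (h * K d)); last by rewrite lerDl.
  apply: (@le_trans _ _ (h * K (enorm (x - s y)))).
    rewrite ler_wpM2r ?frac_kernel_ge0//.
    have := wr y (lt_trans close eps_r); lra.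
  by rewrite ler_wpM2l ?(ltW h0)// frac_kernel_le.
move=> y; have [ly|ly|ly] := ltgtP l (dot y e); first exact: main.
  have sly : l < dot (s y) e by rewrite dot_refl//; lra.
  have nQy : ~ Q y by move=> /HQ[+ _ _]; rewrite ltNge (ltW ly).
  have Qy0 : \1_Q y = 0 :> R by rewrite indicE memNset.
  have Qsy : 0 <= c * \1_Q (s y) by rewrite mulr_ge0.
  have := main (s y) sly; rewrite refl_gap_refl (reflK l e1) opprK Qy0.
  by move: (\1_Q (s y)) Qsy => q q0; lra.
have nQy : ~ Q y by move=> /HQ[+ _ _]; rewrite ly ltxx.
have wy : w y = 0 by rewrite /refl_gap refl_fix// subrr.
rewrite refl_fix// wy subr0 addr0 [\1_Q y]indicE memNset// mulr0 subr0.
apply: (@le_trans _ _ 0); last by rewrite addr_ge0.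
case: ifP => _; last by rewrite addr0.
by rewrite -mulrDl mulr_le0_ge0 ?frac_kernel_ge0//; lra.
Unshelve. all: by end_near. Qed.

End kernel_comparison.

(** * Compactness *)

Section lipschitz.
Context {R : realType}.

(** The hypothesis speaks of all pairs of points of the half-line, diagonal or
   not, so that the compactness of the square [[0, M] x [0, M]] yields a single
   constant. *)
Lemma locally_lipschitz_segment (f : R -> R) (M : R) :
  [locally [lipschitz f t | t in `[0, +oo[ ]] ->
  exists2 L, 0 < L & forall a b, 0 <= a <= M -> 0 <= b <= M ->
    `|f a - f b| <= L * `|a - b|.
Proof.
move=> lip; pose K : set (R * R) := `[0, M]%classic `*` `[0, M]%classic.
have cK : compact K.
  exact: compact_setX (@segment_compact R 0 M) (@segment_compact R 0 M).
pose P (k : R) (p : R * R) := `|f p.1 - f p.2| <= k * `|p.1 - p.2|.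
have A p : K p -> (`[0, +oo[ `*` `[0, +oo[)%classic p.
  by move=> [/= ]; rewrite !in_itv/= !andbT => /andP[? _] /andP[? _].
have /near_covering_withinP cov := (compact_near_coveringP K).1 cK.
have /cov h : forall p, K p ->
    \forall p' \near p & k \near +oo, K p' -> P k p'.
  move=> p Kp; have [k0 [_ Hk]] := lip p (A p Kp).
  have hp : \forall p' \near p, K p' -> P (k0 + 1) p'.
    have := Hk (k0 + 1); rewrite ltrDl => /(_ ltr01).
    rewrite /dominated_by /within /= => H; near=> p' => Kp'.
    have := A _ Kp'; near: p'; exact: H.
  exists ([set p' | K p' -> P (k0 + 1) p'], [set k | k0 + 1 <= k]).
    by split=> //; apply: nbhs_pinfty_ge; exact: num_real.
  move=> [p' k] /= [hp' k01] /hp' le; apply: le_trans le _.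
  exact: ler_wpM2r.
have [k1 [_ Hk1]] := h.
exists (`|k1| + 1); first by rewrite ltr_pwDr.
move=> a b a01 b01.
have := Hk1 (`|k1| + 1); rewrite ltr_pwDr ?ler_norm// => /(_ isT (a, b)).
by apply; split; rewrite /= in_itv.
Unshelve. all: by end_near. Qed.

End lipschitz.

Section unit_ball.
Context {R : realType} {n : nat}.

Lemma compact_cap (e : 'rV[R]_n) (l : R) :
  compact [set x : 'rV[R]_n | enorm x <= 1 /\ l <= dot x e].
Proof.
apply: bounded_closed_compact.
  exists 1; split=> // M M1 x [x1 _]; apply: le_trans (ltW M1).
  rewrite -[leLHS]/(mx_norm x).
  have [->|/mx_norm_neq0[[i j] ->]] := eqVneq (mx_norm x) 0; first exact: ler01.
  by rewrite /= (ord1 i); exact: le_trans (coord_le_enorm x j) x1.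
have -> : [set x : 'rV[R]_n | enorm x <= 1 /\ l <= dot x e] =
    (fun x : 'rV[R]_n => enorm x) @^-1` [set t | t <= 1] `&`
    (fun x : 'rV[R]_n => dot x e) @^-1` [set t | l <= t].
  by [].
apply: closedI; apply: preimage_closed.
- by move=> x _; apply: (@cvg_enorm _ _ _ (nbhs x) _ id x); exact: cvg_id.
- exact: closed_le.
- move=> x _; apply: (@cvg_dot _ _ _ (nbhs x) _ id (fun=> e) x e).
    exact: cvg_id.
  exact: cvg_cst.
- exact: closed_ge.
Qed.

End unit_ball.

(** * Maximum principles and the moving plane *)

Section maximum_principles.
Context {R : realType} {n : nat}.
Let N := n.+1.
Variables (alpha : R) (f : R -> R) (g u : 'rV[R]_n.+1 -> R).
Hypotheses (alpha0 : 0 < alpha)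
  (f_lip : [locally [lipschitz f t | t in `[0, +oo[ ]])
  (g_decr : radially_decreasing_on B1 g)
  (u_sol : classical_solution alpha f g u)
  (u_gt0 : forall x, B1 x -> 0 < u x).
Implicit Types (x y e : 'rV[R]_n.+1) (l : R).

Local Notation w := (refl_gap u).

Let cu : continuous u. Proof. by case: u_sol. Qed.

Let u_out x : 1 <= enorm x -> u x = 0.
Proof.
by move=> x1; case: u_sol => _ _; apply; rewrite /B1 /= ltNge x1.
Qed.

Lemma solution_ge0 x : 0 <= u x.
Proof.
by have [x1|x1] := ltP (enorm x) 1; [exact/ltW/u_gt0|rewrite u_out].
Qed.

Lemma solution_bounded : exists M, forall x, u x <= M.
Proof.
(* With the zero direction, the cap is the whole closed ball. *)
have cK : compact (u @` [set x | enorm x <= 1 /\ 0 <= dot x 0]).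
  apply: continuous_compact; last exact: compact_cap.
  exact: continuous_subspaceT.
have [M [_ HM]] := compact_bounded cK.
exists (`|M| + 1) => x; have [x1|x1] := leP (enorm x) 1; last first.
  by rewrite u_out ?ltW// addr_ge0.
apply: le_trans (ler_norm _) _; apply: HM; first by rewrite ltr_pwDr ?ler_norm.
by exists x => //; split=> //=; rewrite dot0.
Qed.

(** The nonlinearity can only spoil the maximum principle linearly in the gap,
   and [g] helps, since a reflection towards the origin increases it. *)
Lemma frac_laplacian_gap_ge : exists2 L, 0 < L & forall e l x,
  dot e e = 1 -> 0 < l -> l < dot x e -> B1 x -> w e l x <= 0 ->
  L * w e l x <=
    frac_laplacian alpha u (refl e l x) - frac_laplacian alpha u x.
Proof.
have [M HM] := solution_bounded.
have [L L0 HL] := locally_lipschitz_segment M f_lip.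
exists L => // e l x e1 l0 lx Bx wx.
have sx := enorm_refl_lt e1 l0 lx.
have Bsx : B1 (refl e l x) by exact: lt_trans sx Bx.
case: u_sol => _ eqn _; have [_ ->] := eqn _ Bx; have [_ ->] := eqn _ Bsx.
have gx : g x <= g (refl e l x) by apply: g_decr => //; exact: ltW.
have := HL (u (refl e l x)) (u x).
rewrite !solution_ge0 !HM => /(_ isT isT).
rewrite -/(w e l x) (ler0_norm wx) ler_norml => /andP[+ _].
by move: gx; lra.
Qed.

Lemma solution_laplacian_defined x : B1 x -> frac_laplacian_defined alpha u x.
Proof. by case: u_sol => _ eqn _ /eqn[]. Qed.

Let B1_refl e l x : dot e e = 1 -> 0 < l -> l < dot x e -> B1 x ->
  B1 (refl e l x).
Proof.
by move=> e1 l0 lx; apply: lt_trans; exact: enorm_refl_lt.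
Qed.

Lemma cube_enorm x y (r : R) :
  cube x (r / (2 * N%:R)) y -> enorm (x - y) <= r / 2.
Proof.
move=> /cubeP h; apply: le_trans (enorm_le_coord h) _.
have : (N%:R : R) != 0 by rewrite pnatr_eq0.
rewrite -/N; move: (N%:R : R) => t t0.
by rewrite le_eqVlt; apply/orP; left; apply/eqP; field.
Qed.

Let side_gt0 (r : R) : 0 < r -> 0 < r / (2 * N%:R).
Proof. by move=> r0; rewrite divr_gt0// mulr_gt0// ltr0n. Qed.

(** Narrow region principle.  If [x] is at distance [d] from the hyperplane, the
   cube around [x + 2 d e] lies in the half-space, and it alone contributes a
   constant multiple of [w x * d ^ (- 2 alpha)] to the difference of the
   fractional Laplacians; the equation only allows [L * w x]. *)
Lemma negative_minimum_far : exists2 d0 : R, 0 < d0 & forall e l x,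
  dot e e = 1 -> e ord0 ord0 != 0 -> 0 < l -> l < dot x e -> B1 x ->
  w e l x < 0 -> (forall y, l < dot y e -> w e l x <= w e l y) ->
  d0 <= dot x e - l.
Proof.
have [L L0 HL] := frac_laplacian_gap_ge.
(* The bound obtained at the end reads [A <= (5 d)^(2 alpha)]. *)
pose A : R := ((5 * N%:R) ^- N) / L.
have A0 : 0 < A by rewrite divr_gt0// invr_gt0 exprn_gt0// mulr_gt0// ltr0n.
have al2 : 0 < 2 * alpha by rewrite mulr_gt0.
exists (A `^ (2 * alpha)^-1 / 5); first by rewrite divr_gt0// powR_gt0.
move=> e l x e1 e0 l0 lx Bx wx0 wmin; set d := dot x e - l.
have d0 : 0 < d by rewrite subr_gt0.
rewrite ler_pdivrMr//.
pose q := x + (2 * d) *: e; pose r := d / (2 * N%:R).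
have r0 : 0 < r by exact: side_gt0.
(* For [y] in the cube, [5 d] bounds the distance from [x] to the image of [y],
   because [q] is at distance [4 d] from the image of [x]. *)
pose k := frac_kernel (n := n) alpha (5 * d).
have k0 : 0 < k by apply: frac_kernel_gt0; rewrite mulr_gt0.
have HQ y : cube q r y -> [/\ l < dot y e, d <= enorm (x - y) &
    pair_gap alpha u e l x y <= - (- (2 * w e l x * k))].
  move=> /cube_enorm qy.
  have qye : dot (q - y) e <= d / 2 by apply: le_trans (dot_unit_le _ e1) qy.
  have ye : dot x e + (3 / 2) * d <= dot y e.
    by move: qye; rewrite /q !dotE e1; lra.
  have ly : l < dot y e by move: ye d0; rewrite /d; lra.
  have xy : d <= enorm (x - y).
    rewrite enormC; apply: le_trans (dot_unit_le _ e1).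
    by rewrite !dotE; move: ye d0; lra.
  split=> //; rewrite opprK.
  have xy0 : x != y.
    by apply: contraTneq xy => ->; rewrite subrr enorm0 -ltNge.
  apply: le_trans (pair_gap_le alpha0 e1 lx ly xy0 (wmin _ ly)) _.
  apply: ler_wnM2l; first by rewrite pmulr_rle0 ?ltW.
  apply: frac_kernel_le => //.
    exact: lt_le_trans d0 (dist_refl_ge e1 x ly).
  rewrite dist_refl//.
  have -> : refl e l x - y = (q - y) - (4 * d) *: e.
    rewrite refl.unlock -/d /q.
    by apply/rowP => i; rewrite !mxE; ring.
  apply: le_trans (enormD _ _) _.
  rewrite enormN enormZ (enormE e) e1 sqrtr1 mulr1 ger0_norm ?mulr_ge0 ?ltW//.
  by move: qy d0; lra.
have mQ : measurable (cube q r) by exact: measurable_cube.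
have Qoo : (lebesgue_rV N (cube q r) < +oo)%E by rewrite lebesgue_cube// ltry.
have c0 : 0 <= - (2 * w e l x * k).
  by rewrite oppr_ge0 pmulr_lle0// pmulr_rle0// ltW.
have := frac_laplacian_refl_le alpha0 e1 e0 cu (solution_laplacian_defined Bx)
  (solution_laplacian_defined (B1_refl e1 l0 lx Bx)) lx (ltW wx0) wmin mQ Qoo
  c0 d0 HQ.
move=> /(le_trans (HL _ _ _ e1 l0 lx Bx (ltW wx0))).
rewrite lebesgue_cube// [fine _]/= -/N.
rewrite (_ : - (_ / 2) = w e l x * (k * (2 * r) ^+ N)).
  2: by field.
rewrite mulrC ler_nM2l// => kL.
have d5 : 0 < 5 * d by rewrite mulr_gt0.
suff : A <= (5 * d) `^ (2 * alpha).
  move=> Ap; have ip : 0 <= (2 * alpha)^-1 by rewrite invr_ge0 ltW.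
  have Ann : A \in Num.nneg by rewrite nnegrE ltW.
  have pnn : (5 * d) `^ (2 * alpha) \in Num.nneg by rewrite nnegrE powR_ge0.
  have := ge0_ler_powR ip Ann pnn Ap.
  by rewrite -powRrM mulfV ?(gt_eqF al2)// powRr1 ?(ltW d5)// (mulrC d).
move: kL; rewrite /k /frac_kernel powRD ?(gt_eqF d5) ?implybT//.
rewrite powR_mulrn ?(ltW d5)//.
rewrite /A ler_pdivrMr// /r.
have p0 : 0 < (5 * d) `^ (2 * alpha) by exact: powR_gt0.
move: (_ `^ _) p0 => p p0.
have -> : ((5 * d) ^+ n.+1 * p)^-1 * (2 * (d / (2 * N%:R))) ^+ N =
    (5 * N%:R) ^- N / p.
  rewrite invfM mulrAC -!exprVn -/N -exprMn.
  congr (_ ^+ _ / _); have : (N%:R : R) != 0 by rewrite pnatr_eq0.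
  by move: (N%:R : R) => t t0; field; rewrite t0 gt_eqF.
by rewrite ler_pdivrMr// (mulrC p).
Qed.

(** Outside the ball [u] vanishes, and it is nonnegative at the image. *)
Let gap_out e l x : 1 <= enorm x -> 0 <= w e l x.
Proof. by move=> x1; rewrite /refl_gap (u_out x1) subr0 solution_ge0. Qed.

Let pair_bound (v t ka kb k1 k2 : R) : 0 < t -> t < v -> 0 < ka - kb ->
  ka <= k1 -> k2 <= kb -> (0 - v) * k1 + (0 + v) * k2 <= - (t * (ka - kb)).
Proof.
move=> t0 tv kab k1a k2b.
rewrite sub0r add0r mulNr addrC -mulrBr -opprB mulrN lerN2.
apply: (@le_trans _ _ (v * (ka - kb))); first by rewrite ler_wpM2r ?ltW.
by rewrite ler_wpM2l ?lerB// ltW// (lt_trans t0).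
Qed.

(** Strong maximum principle.  On the unit sphere the gap is positive because
   the image lies in the ball.  If it vanished at some [x] in the ball, the
   region around [x / |x|], where it is positive, would make the difference of
   the fractional Laplacians negative at [x], while the equation makes it
   nonnegative. *)
Lemma gap_gt0 e l x : dot e e = 1 -> e ord0 ord0 != 0 -> 0 < l ->
  (forall y, l < dot y e -> 0 <= w e l y) ->
  enorm x <= 1 -> l < dot x e -> 0 < w e l x.
Proof.
move=> e1 e0 l0 w_ge0; rewrite le_eqVlt => /predU1P[x1|x1] lx.
  rewrite /refl_gap (u_out (_ : 1 <= enorm x)) ?x1// subr0; apply: u_gt0.
  by rewrite /B1 /= -x1 enorm_refl_lt.
rewrite lt_neqAle w_ge0// andbT; apply/negP => /eqP wx; have {}wx := esym wx.
have xe0 : 0 < dot x e by exact: lt_trans lx.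
have nx0 : 0 < enorm x by apply: lt_le_trans xe0 (dot_unit_le _ e1).
pose q := (enorm x)^-1 *: x.
have q1 : enorm q = 1.
  by rewrite enormZ ger0_norm ?invr_ge0 ?enorm_ge0// mulVf// gt_eqF.
have lq : l < dot q e.
  rewrite dotZl; apply: lt_le_trans lx _.
  by rewrite ler_peMl ?(ltW xe0)// invf_ge1// ltW.
have wq : 0 < w e l q.
  rewrite /refl_gap (u_out (_ : 1 <= enorm q)) ?q1// subr0; apply: u_gt0.
  by rewrite /B1 /= -q1 enorm_refl_lt.
have xq : 0 < enorm (x - q).
  by apply: enorm_gt0; apply: contraTneq x1 => /subr0_eq ->; rewrite q1 ltxx.
have xsq := enorm_lt_dist_refl e1 lx lq.
(* Near [q], these values keep the two distances apart. *)
pose a := (2 * enorm (x - q) + enorm (x - refl e l q)) / 3.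
pose b := (enorm (x - q) + 2 * enorm (x - refl e l q)) / 3.
have near_q : \forall y \near q,
    [/\ l < dot y e, enorm (x - q) / 2 < enorm (x - y),
    enorm (x - y) < a, b < enorm (x - refl e l y) & w e l q / 2 < w e l y].
  have cB := @continuous_enormB R N x.
  have cxs : enorm (x - refl e l y) @[y --> q] --> enorm (x - refl e l q).
    exact: (@continuous_comp _ _ _ (refl e l) (fun z => enorm (x - z)) q
      (@continuous_refl _ _ e l q) (cB _)).
  have cd : dot y e @[y --> q] --> dot q e.
    apply: (@cvg_dot _ _ _ (nbhs q) _ id (fun=> e) q e); first exact: cvg_id.
    exact: cvg_cst.
  near=> y; split; near: y.
  - exact: cvgr_gt cd _ lq.
  - by apply: (cvgr_gt _ (cB q)); lra.
  - by apply: (cvgr_lt _ (cB q)); rewrite /a; lra.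
  - by apply: (cvgr_gt _ cxs); rewrite /b; lra.
  - by apply: (cvgr_gt _ (@continuous_refl_gap _ _ u e l cu q)); lra.
have /near_enorm[r r0 HQ] := near_q.
have rho0 : 0 < enorm (x - q) / 2 by rewrite divr_gt0.
have a0 : 0 < a by rewrite /a; lra.
have ab : a < b by rewrite /a /b; lra.
pose K := @frac_kernel R n alpha.
pose c := w e l q / 2 * (K a - K b).
have Kab : 0 < K a - K b by rewrite subr_gt0 frac_kernel_lt.
have c0 : 0 < c by rewrite mulr_gt0// divr_gt0.
pose Q := cube q (r / (2 * N%:R)).
have HQ' y : Q y -> [/\ l < dot y e, enorm (x - q) / 2 <= enorm (x - y) &
    pair_gap alpha u e l x y <= - c].
  move=> /cube_enorm qy.
  have [|ly qy2 ya yb wy] := HQ y; first by apply: le_lt_trans qy _; lra.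
  split=> //; first exact: ltW.
  have K1 : K a <= K (enorm (x - y)).
    by apply: frac_kernel_le; [|exact: lt_trans qy2|exact: ltW].
  have K2 : K (enorm (x - refl e l y)) <= K b.
    by apply: frac_kernel_le; [|exact: lt_trans ab|exact: ltW].
  rewrite /pair_gap wx -/K /c.
  by apply: pair_bound => //; rewrite divr_gt0.
have mQ : measurable Q by exact: measurable_cube.
have Qoo : (lebesgue_rV N Q < +oo)%E by rewrite lebesgue_cube ?ltry// side_gt0.
have [L L0 HL] := frac_laplacian_gap_ge.
have wx0 : w e l x <= 0 by rewrite wx.
have wmin y : l < dot y e -> w e l x <= w e l y by rewrite wx; exact: w_ge0.
have := frac_laplacian_refl_le alpha0 e1 e0 cu (solution_laplacian_defined x1)
  (solution_laplacian_defined (B1_refl e1 l0 lx x1)) lx wx0 wmin mQ Qoo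
  (ltW c0) rho0 HQ'.
move=> /(le_trans (HL _ _ _ e1 l0 lx x1 wx0)).
rewrite wx mulr0 lebesgue_cube ?side_gt0//= leNgt oppr_lt0.
by rewrite divr_gt0// mulr_gt0// exprn_gt0// mulr_gt0// side_gt0.
Unshelve. all: by end_near. Qed.

(** The negative part of the gap lives on the compact part of the closed ball
   beyond the hyperplane, and the gap is nonnegative on the boundary of that
   part. *)
Lemma negative_minimum_exists e l y : dot e e = 1 -> 0 < l ->
  l < dot y e -> w e l y < 0 ->
  exists x, [/\ B1 x, l < dot x e, w e l x < 0 &
    forall z, l < dot z e -> w e l x <= w e l z].
Proof.
move=> e1 l0 ly wy; pose A := [set x | enorm x <= 1 /\ l <= dot x e].
have w_ge0 z : 1 <= enorm z -> w e l z < 0 -> False.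
  by move=> /(gap_out e l); rewrite leNgt => /negP.
have Ay : A y.
  split; last exact: ltW.
  by rewrite leNgt; apply/negP => /ltW /w_ge0; apply.
have [||x /set_mem[x1 lx] xmin] :=
  @compact_EVT_min _ R (w e l) A _ (@compact_cap _ _ e l).
- by exists y.
- exact/continuous_subspaceT/continuous_refl_gap.
have wx : w e l x < 0 by apply: le_lt_trans wy; apply: xmin; exact/mem_set.
exists x; split=> //.
- by rewrite /B1 /= ltNge; apply/negP => /w_ge0; apply.
- rewrite lt_neqAle lx andbT; apply: contraTneq wx => lx0.
  by rewrite /refl_gap refl_fix// subrr ltxx.
- move=> z lz; have [z1|/ltW z1] := leP (enorm z) 1.
    by apply: xmin; apply/mem_set; split=> //; exact: ltW.
  exact: le_trans (ltW wx) (gap_out e l z1).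
Qed.

(** The moving plane.  For [l >= 1] nothing of the ball lies beyond the
   hyperplane.  If [l0 > 0] were the infimum of the admissible positions, the
   gap at [l0] would be positive on the part of the closed ball at distance at
   least [d0 / 2] from the hyperplane, hence also for [l] slightly smaller, by
   compactness; by [negative_minimum_far] there is no room left for a negative
   minimum, so that these [l] would be admissible as well. *)
Lemma gap_ge0 e l y : dot e e = 1 -> e ord0 ord0 != 0 -> 0 < l ->
  l < dot y e -> 0 <= w e l y.
Proof.
move=> e1 e0; move: l y.
pose S l := forall y, l < dot y e -> 0 <= w e l y.
pose E := [set l | 0 < l /\ forall l', l <= l' -> S l'].
have E_1 : E 1.
  split=> // l' l'1 y ly; apply: gap_out; apply: le_trans l'1 _.
  exact: le_trans (ltW ly) (dot_unit_le _ e1).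
have E_lb : lbound E 0 by move=> l [/ltW].
have E_inf : has_inf E by split; [exists 1|exists 0].
suff infE : inf E <= 0.
  move=> l y l0 ly.
  have [l1 [_ Hl1] l1l] := inf_lt E_inf.1 (le_lt_trans infE l0).
  exact: Hl1 (ltW l1l) _ ly.
rewrite leNgt; apply/negP; set l0 := inf E => l00.
have S_gt l : l0 < l -> S l.
  by move=> l0l; have [l1 [_ Hl1] /ltW l1l] := inf_lt E_inf.1 l0l; exact: Hl1.
have cw y l : u (refl e l' y) @[l' --> l] --> u (refl e l y).
  have h : refl e l' y @[l' --> l] --> refl e l y.
    by apply: (@cvg_reflection _ _ _ (nbhs l) _ e id (fun=> y) l y);
      [exact: cvg_id|exact: cvg_cst].
  by apply: continuous_cvg; [exact: cu|exact: h].
have S_l0 : S l0.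
  move=> y ly; rewrite /refl_gap subr_ge0 leNgt; apply/negP => lt_u.
  have [eps /= eps0] := (cvgr_lt _ (cw y l0)) _ lt_u.
  move=> /(_ (l0 + Num.min eps (dot y e - l0) / 2)).
  set m := Num.min _ _; have m0 : 0 < m by rewrite lt_min eps0 subr_gt0.
  have [m_eps m_y] : m <= eps /\ m <= dot y e - l0.
    by rewrite /m !ge_min !lexx orbT.
  have := S_gt (l0 + m / 2); rewrite ltrDl divr_gt0// => /(_ isT y).
  have y_far : l0 + m / 2 < dot y e by lra.
  rewrite /refl_gap subr_ge0 leNgt => h1 h2; apply: (negP (h1 y_far)).
  apply: h2; rewrite /= opprD addrA subrr add0r normrN gtr0_norm ?divr_gt0//.
  by lra.
have [d0 d00 far] := negative_minimum_far.
pose K := [set x | enorm x <= 1 /\ l0 + d0 / 2 <= dot x e].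
have /compact_near_coveringP/near_covering_withinP cov : compact K.
  exact: compact_cap.
pose P l x : Prop := 0 < w e l x.
have /cov[eps /= eps0 Heps] : forall x, K x ->
    \forall x' \near x & l \near l0, K x' -> P l x'.
  move=> x [x1 lx].
  have wx : 0 < w e l0 x by apply: gap_gt0 => //; lra.
  have cwx : refl_gap u e p.2 p.1 @[p --> (x, l0)] --> w e l0 x.
    have h : refl e p.2 p.1 @[p --> (x, l0)] --> refl e l0 x.
      by apply: (@cvg_reflection _ _ _ (nbhs (x, l0)) _ e snd fst l0 x);
        [exact: cvg_snd|exact: cvg_fst].
    have h1 : u (p.1) @[p --> (x, l0)] --> u x.
      by apply: continuous_cvg; [exact: cu|exact: cvg_fst].
    have h2 : u (refl e p.2 p.1) @[p --> (x, l0)] --> u (refl e l0 x).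
      by apply: continuous_cvg; [exact: cu|exact: h].
    exact: cvgB h2 h1.
  have : \forall p \near (x, l0), 0 < w e p.2 p.1 by exact: (cvgr_gt _ cwx).
  by apply: filterS => -[x' l'] h _; exact: h.
pose m := Num.min eps (Num.min (d0 / 2) l0) / 2.
have m0 : 0 < m by rewrite divr_gt0// !lt_min eps0 l00 divr_gt0.
have [m_eps m_d0 m_l0] : [/\ m < eps, m < d0 / 2 & m < l0].
  have [h1 h2 h3] : [/\ 2 * m <= eps, 2 * m <= d0 / 2 & 2 * m <= l0].
    by rewrite mulrC divfK// !ge_min !lexx !orbT.
  by split; lra.
have : E (l0 - m).
  split=> [|l lm]; first by rewrite subr_gt0.
  have [|ll0] := ltP l0 l; first exact: S_gt.
  move=> y ly; rewrite leNgt; apply/negP => wy.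
  have l_gt0 : 0 < l by apply: lt_le_trans lm; rewrite subr_gt0.
  have [x [Bx lx wx xmin]] := negative_minimum_exists e1 l_gt0 ly wy.
  have d0x := far e l x e1 e0 l_gt0 lx Bx wx xmin.
  have Kx : K x by split; [exact: ltW|lra].
  suff : 0 < w e l x by rewrite ltNge (ltW wx).
  by apply: Heps Kx; rewrite /= ltr_distl; lra.
by move=> /(ge_inf E_inf.2); rewrite -/l0; lra.
Qed.

End maximum_principles.

(** * Radial monotonicity *)

Section radial_monotonicity.
Context {R : realType} {n : nat}.
Variables (alpha : R) (f : R -> R) (g u : 'rV[R]_n.+1 -> R).
Hypotheses (alpha0 : 0 < alpha)
  (f_lip : [locally [lipschitz f t | t in `[0, +oo[ ]])
  (g_decr : radially_decreasing_on B1 g)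
  (u_sol : classical_solution alpha f g u)
  (u_gt0 : forall x, B1 x -> 0 < u x).
Implicit Types x y z : 'rV[R]_n.+1.

(** The hyperplane that exchanges [x] and [y] separates [y] from the origin when
   [y] is the farther of the two, and its normal has a nonzero first coordinate
   when the first coordinates of [x] and [y] differ. *)
Lemma solution_lt_first_coord x y : enorm x < enorm y -> enorm y <= 1 ->
  x ord0 ord0 != y ord0 ord0 -> u y < u x.
Proof.
move=> xy y1 xy0; pose v := y - x.
have v0 : 0 < enorm v.
  by apply: enorm_gt0; rewrite subr_eq0; apply: contraNneq xy0 => ->.
pose e := (enorm v)^-1 *: v; pose l := dot (x + y) e / 2.
have e1 : dot e e = 1.
  by rewrite /e dotZl dotZr -(sqr_enorm v); field; rewrite gt_eqF.
have e0 : e ord0 ord0 != 0.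
  rewrite !mxE; apply: mulf_neq0; first by rewrite invr_eq0 gt_eqF.
  by rewrite subr_eq0 eq_sym.
have ve : dot v e = enorm v.
  by rewrite /e dotZr -(sqr_enorm v) expr2 mulKf// gt_eqF.
have l0 : 0 < l.
  rewrite divr_gt0// dotZr mulr_gt0 ?invr_gt0// /v !dotE (dotC y x).
  by move: xy; rewrite enorm_lt; lra.
have ly : l < dot y e by move: ve v0; rewrite /l /v !dotDl dotNl; lra.
have ryx : refl e l y = x.
  rewrite refl.unlock (_ : 2 * (dot y e - l) = enorm v).
    by rewrite scalerA mulfV ?gt_eqF// scale1r /v opprB addrC subrK.
  by rewrite -ve /l /v !dotDl dotNl; field.
have := gap_gt0 alpha0 f_lip g_decr u_sol u_gt0 e1 e0 l0
  (fun z => @gap_ge0 _ _ _ _ _ _ alpha0 f_lip g_decr u_sol u_gt0 e l z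
    e1 e0 l0) y1 ly.
by rewrite /refl_gap ryx subr_gt0.
Qed.

Lemma same_enorm_first_coord x : x != 0 ->
  exists2 z : 'rV[R]_n.+1, enorm z = enorm x & z ord0 ord0 != x ord0 ord0.
Proof.
move=> x0; have [x00|x00] := eqVneq (x ord0 ord0) 0.
  exists (enorm x *: delta_mx ord0 ord0).
    have d1 : enorm (delta_mx ord0 ord0 : 'rV[R]_n.+1) = 1.
      rewrite enormE /dot big_ord_recl big1.
        by rewrite !mxE !eqxx/= mulr1 addr0 sqrtr1.
      by move=> i _; rewrite !mxE eq_sym /= mulr0.
    by rewrite enormZ d1 mulr1 ger0_norm ?enorm_ge0.
  by rewrite !mxE !eqxx mulr1 x00 gt_eqF// enorm_gt0.
exists (- x); first exact: enormN.
by rewrite mxE; apply: contraNneq x00 => x00; apply/eqP; lra.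
Qed.

(** Two points of equal norm are compared by shrinking one of them slightly; if
   they have the same first coordinate, a third point is put in between. *)
Lemma solution_radial : radially_symmetric_on setT u.
Proof.
have le x y : enorm x = enorm y -> enorm y < 1 ->
    x ord0 ord0 != y ord0 ord0 -> u y <= u x.
  move=> xy y1 xy0; have x0 : 0 < enorm x.
    apply: enorm_gt0; apply: contraNneq xy0 => x0; move: xy; rewrite x0 enorm0.
    by move=> /esym/eqP; rewrite enorm_eq0 => /eqP->.
  rewrite leNgt; apply/negP => lt_u.
  have cu : continuous u by case: u_sol.
  have tx : t *: x @[t --> (1 : R)] --> x.
    by rewrite -[X in _ --> X](scale1r x); apply: cvgZr_tmp; exact: cvg_id.
  have utx : u (t *: x) @[t --> (1 : R)] --> u x.
    by apply: continuous_cvg; [exact: cu|exact: tx].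
  have tx0 : t * x ord0 ord0 @[t --> (1 : R)] --> x ord0 ord0.
    rewrite -[X in _ --> X]mul1r.
    by apply: cvgM; [exact: cvg_id|exact: cvg_cst].
  have H : \forall t \near (1 : R)^'-, [/\ 0 < t, t < 1, u (t *: x) < u y &
      t * x ord0 ord0 != y ord0 ord0].
    near=> t; split; near: t.
    - exact: nbhs_left_gt.
    - exact: nbhs_left_lt.
    - exact: (cvgr_lt _ (cvg_at_left_filter utx)).
    - have d0 : x ord0 ord0 - y ord0 ord0 != 0 by rewrite subr_eq0.
      have td : t * x ord0 ord0 - y ord0 ord0 @[t --> (1 : R)] -->
          x ord0 ord0 - y ord0 ord0.
        by apply: (cvgB tx0); exact: cvg_cst.
      near=> t; rewrite -subr_eq0; near: t.
      exact: (cvgr_neq0 _ (cvg_at_left_filter td) d0).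
  have [t [t0 t1 tu ty]] := filter_ex H.
  suff : u y < u (t *: x) by rewrite ltNge (ltW tu).
  apply: solution_lt_first_coord; [|exact: ltW|by rewrite mxE].
  by rewrite enormZ gtr0_norm// -xy gtr_pMl.
have eq x y : enorm x = enorm y -> enorm y < 1 ->
    x ord0 ord0 != y ord0 ord0 -> u x = u y.
  move=> xy y1 xy0; apply/eqP; rewrite eq_le !le// ?xy//.
  by rewrite eq_sym.
move=> x y _ _ xy; have [y1|y1] := ltP (enorm y) 1; last first.
  by case: u_sol => _ _ u0; rewrite !u0// /B1 /= ?xy; apply/negP; rewrite -leNgt.
have [xy0|] := eqVneq (x ord0 ord0) (y ord0 ord0); last exact: eq.
have [x0|x0] := eqVneq x 0.
  by move: xy; rewrite x0 enorm0 => /esym/eqP; rewrite enorm_eq0 => /eqP->.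
have [z zx zx0] := same_enorm_first_coord x0.
rewrite (eq x z); [|by []|by rewrite zx xy|by rewrite eq_sym].
by apply: eq => //; rewrite ?zx// -xy0.
Unshelve. all: by end_near. Qed.

Lemma solution_strictly_decreasing :
  radially_strictly_decreasing_on [set x | 0 < enorm x < 1] u.
Proof.
move=> x y /= /andP[x0 _] /andP[_ y1] xy.
have xn0 : x != 0 by apply: contraTneq x0 => ->; rewrite enorm0 ltxx.
have [xy0|xy0] := eqVneq (x ord0 ord0) (y ord0 ord0); last first.
  exact: solution_lt_first_coord (ltW y1) xy0.
have [z zx zx0] := same_enorm_first_coord xn0.
rewrite (solution_radial (x := x) (y := z))//.
by apply: solution_lt_first_coord; rewrite ?zx// -?xy0// ltW.
Qed.

End radial_monotonicity.

Theorem theorem1p1 (R : realType) (N : nat) (alpha : R)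
    (f : R -> R) (g u : 'rV[R]_N -> R) :
  (2 <= N)%N ->
  0 < alpha < 1 ->
  [locally [lipschitz f t | t in `[0, +oo[ ]] ->
  radially_symmetric_on B1 g ->
  radially_decreasing_on B1 g ->
  classical_solution alpha f g u ->
  (forall x, B1 x -> 0 < u x) ->
  radially_symmetric_on setT u /\
  radially_strictly_decreasing_on [set x | 0 < enorm x < 1] u.
Proof.
case: N g u => [//|n] g u _ /andP[alpha0 _] f_lip _ g_decr u_sol u_gt0; split.
  exact: solution_radial alpha0 f_lip g_decr u_sol u_gt0.
exact: solution_strictly_decreasing alpha0 f_lip g_decr u_sol u_gt0.
Qed.
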